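(* Let $\mathcal{H}_1,\mathcal{H}_2$ and $\mathcal{H}$ be right quaternionic Hilbert spaces and let $L\in \mathbb{B}(\mathcal{H}_1,\mathcal{H})$ and $M\in \mathbb{B}(\mathcal{H}_2,\mathcal{H})$. Then the following statements are equivalent: 1. $R(L)\subset R(M)$. 2. There exists a constant $c>0$ such that $LL^*\leq c\,MM^*$. 3. There exists $X\in \mathbb{B}(\mathcal{H}_1,\mathcal{H}_2)$ such that $L=MX$.
   Context: $\mathbb{H}$ denotes the skew field of quaternions. A right quaternionic Hilbert space is a right $\mathbb{H}$-vector space with an inner product $\langle\cdot,\cdot\rangle$ valued in $\mathbb{H}$ satisfying $\langle u,v\rangle=\overline{\langle v,u\rangle}$, $\langle u,u\rangle>0$ for $u\neq 0$, additivity in the second variable and $\langle u,vq\rangle=\langle u,v\rangle q$ for $q\in\mathbb{H}$, complete for the norm $\|u\|=\sqrt{\langle u,u\rangle}$. $\mathbb{B}(\mathcal{H},\mathcal{K})$ is the set of bounded right $\mathbb{H}$-linear operators from $\mathcal{H}$ to $\mathcal{K}$; $L^*$ is the adjoint and $R(L)$ the range of $L$. For self-adjoint operators $A,B$ on $\mathcal{H}$, $A\le B$ means $\langle Au,u\rangle\le\langle Bu,u\rangle$ for all $u\in\mathcal{H}$; thus $LL^*\le c\,MM^*$ means $\langle LL^*u,u\rangle\le c\langle MM^*u,u\rangle$ for all $u\in\mathcal{H}$. *)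

(* Defs.v *)
From HB Require Import structures.
From mathcomp Require Import all_boot all_order all_algebra.
From mathcomp Require Import ring.
From mathcomp Require Import all_classical all_reals all_analysis.
Set Implicit Arguments.
Unset Strict Implicit.
Unset Printing Implicit Defensive.
Import Order.TTheory GRing.Theory Num.Theory.
Import numFieldNormedType.Exports.
Local Open Scope classical_set_scope.
Local Open Scope ring_scope.

Record quaternion (R : Type) := Quat { qre : R; qim_i : R; qim_j : R; qim_k : R }.

Section QuaternionCan.
Variable R : Type.
Definition quat_to_prod (q : quaternion R) : R * R * R * R :=
  (qre q, qim_i q, qim_j q, qim_k q).
Definition quat_of_prod (t : R * R * R * R) : quaternion R :=
  let: (a, b, c, d) := t in Quat a b c d.
Lemma quat_to_prodK : cancel quat_to_prod quat_of_prod.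
Proof. by case. Qed.
End QuaternionCan.

HB.instance Definition _ (R : choiceType) :=
  Choice.copy (quaternion R) (can_type (@quat_to_prodK R)).

Section QuaternionRing.
Variable R : realType.
Local Notation H := (quaternion R).
Implicit Types p q r : H.

Lemma quatP p q : qre p = qre q -> qim_i p = qim_i q -> qim_j p = qim_j q ->
  qim_k p = qim_k q -> p = q.
Proof. by case: p q => ? ? ? ? [? ? ? ?] /= -> -> -> ->. Qed.

Definition quat0 : H := Quat 0 0 0 0.
Definition quat1 : H := Quat 1 0 0 0.
Definition quat_opp p : H := Quat (- qre p) (- qim_i p) (- qim_j p) (- qim_k p).
Definition quat_add p q : H :=
  Quat (qre p + qre q) (qim_i p + qim_i q) (qim_j p + qim_j q) (qim_k p + qim_k q).

(* i^2 = j^2 = k^2 = ijk = -1. *)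
Definition quat_mul p q : H :=
  let: Quat a b c d := p in let: Quat a' b' c' d' := q in
  Quat (a * a' - b * b' - c * c' - d * d')
       (a * b' + b * a' + c * d' - d * c')
       (a * c' - b * d' + c * a' + d * b')
       (a * d' + b * c' - c * b' + d * a').

Definition quat_conj p : H := Quat (qre p) (- qim_i p) (- qim_j p) (- qim_k p).

Definition quat_normsq p : R :=
  qre p ^+ 2 + qim_i p ^+ 2 + qim_j p ^+ 2 + qim_k p ^+ 2.

Definition quat_inv p : H :=
  Quat (qre p / quat_normsq p) (- qim_i p / quat_normsq p)
       (- qim_j p / quat_normsq p) (- qim_k p / quat_normsq p).

Fact quat_addA : associative quat_add.
Proof. by move=> *; apply: quatP => /=; rewrite addrA. Qed.
Fact quat_addC : commutative quat_add.
Proof. by move=> *; apply: quatP => /=; rewrite addrC. Qed.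
Fact quat_add0 : left_id quat0 quat_add.
Proof. by move=> *; apply: quatP => /=; rewrite add0r. Qed.
Fact quat_addN : left_inverse quat0 quat_opp quat_add.
Proof. by move=> *; apply: quatP => /=; rewrite addNr. Qed.

HB.instance Definition _ :=
  GRing.isZmodule.Build H quat_addA quat_addC quat_add0 quat_addN.

Fact quat_mulA : associative quat_mul.
Proof. by move=> [????] [????] [????]; apply: quatP => /=; ring. Qed.
Fact quat_mul1l : left_id quat1 quat_mul.
Proof. by move=> [????]; apply: quatP => /=; ring. Qed.
Fact quat_mul1r : right_id quat1 quat_mul.
Proof. by move=> [????]; apply: quatP => /=; ring. Qed.
Fact quat_mulDl : left_distributive quat_mul quat_add.
Proof. by move=> [????] [????] [????]; apply: quatP => /=; ring. Qed.
Fact quat_mulDr : right_distributive quat_mul quat_add.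
Proof. by move=> [????] [????] [????]; apply: quatP => /=; ring. Qed.
Fact quat_1neq0 : quat1 != 0 :> H.
Proof. by apply/eqP => -[] /eqP; rewrite oner_eq0. Qed.

HB.instance Definition _ := GRing.Zmodule_isNzRing.Build H
  quat_mulA quat_mul1l quat_mul1r quat_mulDl quat_mulDr quat_1neq0.

Lemma quat_normsq_eq0 p : (quat_normsq p == 0) = (p == 0).
Proof.
apply/eqP/eqP => [|->]; last by rewrite /quat_normsq /= expr0n /= !addr0.
move/eqP; rewrite /quat_normsq !paddr_eq0 ?addr_ge0 ?sqr_ge0// !sqrf_eq0.
by move=> /andP[/andP[/andP[/eqP ? /eqP ?] /eqP ?] /eqP ?]; apply: quatP.
Qed.

Fact quat_mulVl : {in predC1 0, left_inverse 1 quat_inv *%R}.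
Proof.
move=> p; rewrite inE -quat_normsq_eq0; case: p => a b c d.
by rewrite /quat_normsq /= => nz; apply: quatP => /=; rewrite /quat_normsq /=; field.
Qed.
Fact quat_mulVr : {in predC1 0, right_inverse 1 quat_inv *%R}.
Proof.
move=> p; rewrite inE -quat_normsq_eq0; case: p => a b c d.
by rewrite /quat_normsq /= => nz; apply: quatP => /=; rewrite /quat_normsq /=; field.
Qed.
Fact quat_unitP p q : q * p = 1 /\ p * q = 1 -> predC1 0 p.
Proof.
case=> qp _; apply/eqP => p0; move/eqP: qp.
by rewrite p0 mulr0 eq_sym oner_eq0.
Qed.
Fact quat_inv_out : {in [predC (predC1 0)], quat_inv =1 id}.
Proof.
move=> p; rewrite !inE negbK => /eqP->.
by apply: quatP; rewrite /= ?oppr0 mul0r.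
Qed.

HB.instance Definition _ := GRing.NzRing_hasMulInverse.Build H
  quat_mulVl quat_mulVr quat_unitP quat_inv_out.

Lemma quat_unitE p : (p \is a GRing.unit) = (p != 0).
Proof. by []. Qed.

(* As for complex numbers: p <= q iff q - p is a nonnegative real number. *)
Definition quat_le p q : bool :=
  [&& qim_i p == qim_i q, qim_j p == qim_j q, qim_k p == qim_k q & qre p <= qre q].
Definition quat_lt p q : bool :=
  [&& qim_i p == qim_i q, qim_j p == qim_j q, qim_k p == qim_k q & qre p < qre q].

Fact quat_lt_def p q : quat_lt p q = (q != p) && quat_le p q.
Proof.
rewrite /quat_lt /quat_le lt_def; case: p q => a b c d [a' b' c' d'] /=.
case: (b =P b') => [->|_]; last by rewrite /= andbF.
case: (c =P c') => [->|_]; last by rewrite /= andbF.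
case: (d =P d') => [->|_]; last by rewrite /= andbF.
by rewrite /=; congr (~~ _ && _); apply/eqP/eqP => [->|[->]].
Qed.
Fact quat_le_refl : reflexive quat_le.
Proof. by move=> p; rewrite /quat_le !eqxx lexx. Qed.
Fact quat_le_anti : antisymmetric quat_le.
Proof.
move=> p q /andP[/and4P[/eqP ? /eqP ? /eqP ? pq] /and4P[_ _ _ qp]].
by apply: quatP => //; apply/eqP; rewrite eq_le pq.
Qed.
Fact quat_le_trans : transitive quat_le.
Proof.
move=> q p r /and4P[/eqP pi /eqP pj /eqP pk pq] /and4P[/eqP qi /eqP qj /eqP qk qr].
by apply/and4P; split; rewrite ?pi ?pj ?pk ?qi ?qj ?qk// (le_trans pq).
Qed.

HB.instance Definition _ := Order.isPOrder.Build ring_display H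
  quat_lt_def quat_le_refl quat_le_anti quat_le_trans.

Definition quat_of_real (a : R) : H := Quat a 0 0 0.

End QuaternionRing.

Notation "x %:quat" := (quat_of_real x) (at level 2, format "x %:quat") : ring_scope.

(* A right vector space over the quaternions is a left module over the converse
   ring: the right multiple v q is (q : (quaternion R)^c) *: v, so that
   r *: (q *: v) = (q * r) *: v with the product taken in quaternion R. *)
HB.mixin Record isRightPreHilbert (R : realType) V
    & GRing.Lmodule (quaternion R)^c V := {
  hinner : V -> V -> quaternion R;
  hinnerC : forall u v, hinner u v = quat_conj (hinner v u);
  hinner_gt0 : forall u, u != 0 -> 0 < hinner u u;
  hinnerDr : forall u v w, hinner u (v + w) = hinner u v + hinner u w;
  hinnerZr : forall u v (q : quaternion R),
    hinner u ((q : (quaternion R)^c) *: v) = hinner u v * q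
}.

#[short(type="rightPreHilbertType")]
HB.structure Definition RightPreHilbert (R : realType) :=
  { V of isRightPreHilbert R V & GRing.Lmodule (quaternion R)^c V }.

Notation "⟨ u , v ⟩" := (hinner u v)
  (at level 0, u at level 99, v at level 99, format "⟨ u ,  v ⟩") : ring_scope.

(* ⟨u, u⟩ is a nonnegative real, hence equal to its real part. *)
Definition hnorm (R : realType) (V : rightPreHilbertType R) (u : V) : R :=
  Num.sqrt (qre ⟨u, u⟩).

HB.mixin Record isRightHilbert (R : realType) V & RightPreHilbert R V := {
  hcomplete : forall x : nat -> V,
    (forall e : R, 0 < e -> \forall m & n \near \oo, hnorm (x m - x n) < e) ->
    exists l : V, hnorm (x n - l) @[n --> \oo] --> (0 : R)
}.

#[short(type="rightHilbertType")]
HB.structure Definition RightHilbert (R : realType) :=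
  { V of isRightHilbert R V & RightPreHilbert R V }.

HB.mixin Record isBoundedOp (R : realType) (U V : rightHilbertType R)
    (f : U -> V) := {
  opbounded : exists k : R, forall u : U, hnorm (f u) <= k * hnorm u
}.

#[short(type="boundedOpType")]
HB.structure Definition BoundedOp (R : realType) (U V : rightHilbertType R) :=
  { f of isBoundedOp R U V f
       & @GRing.Linear (quaternion R)^c U V ( *:%R ) f }.

Notation "''B(' U , V )" := (boundedOpType U V)
  (at level 0, format "''B(' U ,  V )") : type_scope.

(* For bounded L the set below is a singleton for every v: existence is the
   Riesz representation theorem, uniqueness follows from hinner_gt0. *)
Definition adjoint (R : realType) (U V : rightHilbertType R) (L : 'B(U, V))
  : V -> U := fun v => xget 0 [set w | forall u, ⟨L u, v⟩ = ⟨u, w⟩].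

Notation "L ^†" := (adjoint L) (at level 2, format "L ^†") : ring_scope.

(* Main.v *)
Require Import Defs.
From HB Require Import structures.
From mathcomp Require Import all_boot all_order all_algebra.
From mathcomp Require Import ring lra.
From mathcomp Require Import all_classical all_reals all_analysis.
Set Implicit Arguments.
Unset Strict Implicit.
Unset Printing Implicit Defensive.
Import Order.TTheory GRing.Theory Num.Theory.
Import numFieldNormedType.Exports.
Local Open Scope classical_set_scope.
Local Open Scope ring_scope.

(** This is Douglas' range inclusion theorem over the quaternions.

    The real part of the quaternionic inner product makes every right
    quaternionic Hilbert space a real Hilbert space with the same norm.
    All estimates are done there; quaternionic identities are recovered from
    real parts because a quaternion p is determined by the real parts of the
    products p * r (quat_eq_of_re).

    Since [⟨L (L^† u), u⟩] is the square of the norm of [L^† u], the operator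
    inequality says that the norm of [L^† u] is at most a constant times that
    of [M^† u].

    - If the range of L lies in that of M, write [L x = M y].  For u with
      [M^† u] in the unit ball, [⟨L^† u, x⟩ = ⟨u, L x⟩ = ⟨M^† u, y⟩] is bounded
      by the norm of y, so the vectors [L^† u] form a weakly bounded set.
      Uniform boundedness bounds their norms, and homogeneity turns this into
      the desired inequality (range_sub_adjoint_bound).

    - If the inequality holds, then for each x the value [⟨x, L^† u⟩] depends
      boundedly on [M^† u], and a Riesz theorem for functionals on the range of
      an operator represents it as [⟨y, M^† u⟩] with y in the closure of the
      range of [M^†].  This says [M y = L x], and y is orthogonal to the kernel
      of M; hence y is unique, so that it depends linearly on x, with the bound
      supplied by the representation (adjoint_bound_factor).

    - A factorisation [L = M \o X] gives the range inclusion at once.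

    The representation theorem riesz_along_operator also yields adjoints, as
    its case where the operator is the identity.  It is proved by minimising
    the quadratic energy [|A u|^2 - 2 Re (phi u)]. *)

(** * Quaternions and their real parts *)

Section QuaternionFacts.
Variable R : realType.
Implicit Types p q : quaternion R.

Lemma qre_conj p : qre (quat_conj p) = qre p.
Proof. by []. Qed.

Lemma qreM p q :
  qre (p * q) = qre p * qre q - qim_i p * qim_i q - qim_j p * qim_j q
                - qim_k p * qim_k q.
Proof. by case: p q => ???? []. Qed.

Lemma qre_mul_real (a : R) p : qre (p * a%:quat) = qre p * a.
Proof. by rewrite qreM /= !mulr0 !subr0. Qed.

Lemma quat_conjK : involutive (@quat_conj R).
Proof. by case=> ????; apply: quatP => /=; rewrite ?opprK. Qed.

Lemma quat_eq_of_re p q :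
  (forall r, qre (p * r) = qre (q * r)) -> p = q.
Proof.
case: p q => a b c d [a' b' c' d'] E.
move: (E (Quat 1 0 0 0)) (E (Quat 0 1 0 0)) (E (Quat 0 0 1 0)) (E (Quat 0 0 0 1)).
by rewrite !qreM /= => *; apply: quatP => /=; lra.
Qed.

Lemma real_quatM (a b : R) : a%:quat * b%:quat = (a * b)%:quat.
Proof. by apply: quatP => /=; ring. Qed.

Lemma ler_real_quat (a b : R) : (a%:quat <= b%:quat) = (a <= b).
Proof. by rewrite [LHS]/<=%O /= /quat_le /= !eqxx. Qed.

End QuaternionFacts.

(** * The underlying real inner product space *)

Section RealInnerProduct.
Variables (R : realType) (V : rightPreHilbertType R).
Implicit Types (a b : R) (u v w : V).

Definition rdot u v : R := qre ⟨u, v⟩.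
Definition rscale a u : V := (a%:quat : (quaternion R)^c) *: u.

Lemma rdotC u v : rdot u v = rdot v u.
Proof. by rewrite /rdot hinnerC qre_conj. Qed.

Lemma rdotDr u v w : rdot u (v + w) = rdot u v + rdot u w.
Proof. by rewrite /rdot hinnerDr. Qed.

Lemma rdotDl u v w : rdot (u + v) w = rdot u w + rdot v w.
Proof. by rewrite rdotC rdotDr !(rdotC w). Qed.

Lemma rdotZr a u v : rdot u (rscale a v) = a * rdot u v.
Proof. by rewrite /rdot hinnerZr qre_mul_real mulrC. Qed.

Lemma rdotZl a u v : rdot (rscale a u) v = a * rdot u v.
Proof. by rewrite rdotC rdotZr rdotC. Qed.

Lemma hinner0r u : ⟨u, (0 : V)⟩ = 0.
Proof. by apply: (addrI ⟨u, 0⟩); rewrite -hinnerDr !addr0. Qed.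

Lemma rdot0r u : rdot u 0 = 0.
Proof. by rewrite /rdot hinner0r. Qed.

Lemma rdotNr u v : rdot u (- v) = - rdot u v.
Proof. by apply/eqP; rewrite -addr_eq0 -rdotDr addNr rdot0r. Qed.

Lemma rdotNl u v : rdot (- u) v = - rdot u v.
Proof. by rewrite rdotC rdotNr rdotC. Qed.

Definition rdotE := (rdotDr, rdotDl, rdotNr, rdotNl, rdotZr, rdotZl).

Lemma rdot_gt0 u : u != 0 -> 0 < rdot u u.
Proof. by move=> /(hinner_gt0 (s := V)) /and4P[]. Qed.

Lemma rdot_ge0 u : 0 <= rdot u u.
Proof.
by have [->|/rdot_gt0/ltW//] := eqVneq u 0; rewrite rdot0r.
Qed.

Lemma hnorm_sqr u : hnorm u ^+ 2 = rdot u u.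
Proof. by rewrite sqr_sqrtr ?rdot_ge0. Qed.

Lemma hnorm_ge0 u : 0 <= hnorm u.
Proof. exact: sqrtr_ge0. Qed.

Lemma hnorm0 : hnorm (0 : V) = 0.
Proof. by rewrite /hnorm -/(rdot 0 0) rdot0r sqrtr0. Qed.

Lemma hnorm_eq0 u : hnorm u = 0 -> u = 0.
Proof.
move=> u0; apply/eqP/negP => /negP/rdot_gt0.
by rewrite -hnorm_sqr u0 expr0n ltxx.
Qed.

Lemma hnormN u : hnorm (- u) = hnorm u.
Proof. by rewrite /hnorm -/(rdot _ _) !rdotE opprK. Qed.

Lemma hnormB u v : hnorm (u - v) = hnorm (v - u).
Proof. by rewrite -hnormN opprB. Qed.

Lemma hnormZ a u : hnorm (rscale a u) = `|a| * hnorm u.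
Proof.
by rewrite /hnorm -/(rdot _ _) !rdotE mulrA -expr2 sqrtrM ?sqr_ge0// sqrtr_sqr.
Qed.

Lemma hnorm_le u a : 0 <= a -> rdot u u <= a ^+ 2 -> hnorm u <= a.
Proof. by move=> a0; rewrite -hnorm_sqr ler_pXn2r// nnegrE ?hnorm_ge0. Qed.

(** Cauchy-Schwarz, from the positivity of the square of [|v| u - |u| v]. *)
Lemma rdot_le u v : rdot u v <= hnorm u * hnorm v.
Proof.
have [/hnorm_eq0->|u0] := eqVneq (hnorm u) 0.
  by rewrite hnorm0 rdotC rdot0r mul0r.
have [/hnorm_eq0->|v0] := eqVneq (hnorm v) 0.
  by rewrite hnorm0 rdot0r mulr0.
have p0 : 0 < hnorm u * hnorm v by rewrite mulr_gt0// lt0r ?u0 ?v0 hnorm_ge0.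
have := rdot_ge0 (rscale (hnorm v) u - rscale (hnorm u) v).
rewrite !rdotE (rdotC v u) -!hnorm_sqr => h.
by rewrite -(ler_pM2l p0); lra.
Qed.

Lemma rdot_abs_le u v : `|rdot u v| <= hnorm u * hnorm v.
Proof.
by rewrite ler_norml rdot_le andbT lerNl -rdotNr -(hnormN v) rdot_le.
Qed.

Lemma hnormD u v : hnorm (u + v) <= hnorm u + hnorm v.
Proof.
apply: hnorm_le; first by rewrite addr_ge0// hnorm_ge0.
rewrite sqrrD !hnorm_sqr !rdotE (rdotC v u).
by have := rdot_le u v; lra.
Qed.

Lemma hinner_ext u v : (forall w, ⟨w, u⟩ = ⟨w, v⟩) -> u = v.
Proof.
move=> E; apply/eqP; rewrite -subr_eq0; apply/eqP/hnorm_eq0/eqP.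
by rewrite -sqrf_eq0 hnorm_sqr rdotDr rdotNr /rdot E subrr.
Qed.

Lemma hinner_self u : ⟨u, u⟩ = (hnorm u ^+ 2)%:quat.
Proof.
rewrite hnorm_sqr /rdot; have := hinnerC (s := V) u u.
by case: ⟨u, u⟩ => a b c d [] /= ? ? ?; apply: quatP => /=; lra.
Qed.

End RealInnerProduct.

(** Passing to the limit in the hypothesis keeps the rate r, so that both
    limit constructions below come with an explicit error. *)
Lemma cauchy_modulus_limit (R : realType) (V : rightHilbertType R)
    (x : nat -> V) (r : nat -> R) :
  r n @[n --> \oo] --> (0 : R) ->
  (forall n m, (n <= m)%N -> hnorm (x m - x n) <= r n) ->
  exists l, forall n, hnorm (x n - l) <= r n.
Proof.
move=> r0 xr.
have small e : 0 < e -> exists N, forall n, (N <= n)%N -> r n < e.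
  move=> e0; have /cvgrPdist_lt/(_ e e0) [N _ rN] := r0.
  exists N => n Nn; have := rN n Nn; rewrite /= sub0r normrN.
  exact/le_lt_trans/ler_norm.
have [|l xl] := hcomplete (s := V) x.
  move=> e e0; have [N rN] := small _ (divr_gt0 e0 (ltr0n R 2)).
  near=> m n.
  have Nm : (N <= m)%N by near: m; exists N.
  have Nn : (N <= n)%N by near: n; exists N.
  rewrite -[x m - x n](subrKA (x N)).
  have := hnormD (x m - x N) (x N - x n); rewrite (hnormB (x N)).
  by have := xr _ _ Nm; have := xr _ _ Nn; have := rN _ (leqnn N); lra.
exists l => n; apply/ler_addgt0Pr => e e0.
have /cvgrPdist_lt/(_ e e0) [N _ lN] := xl.
have := lN (maxn N n) (leq_maxl _ _); rewrite /= sub0r normrN.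
rewrite ger0_norm ?hnorm_ge0// -[x n - l](subrKA (x (maxn N n))) => le.
have := hnormD (x n - x (maxn N n)) (x (maxn N n) - l).
by have := xr _ _ (leq_maxr N n); rewrite hnormB; lra.
Unshelve. all: by end_near. Qed.
Lemma hnorm_parallelogram (R : realType) (V : rightPreHilbertType R) (u v : V) :
  hnorm (u + v) ^+ 2 + hnorm (u - v) ^+ 2 = 2 * hnorm u ^+ 2 + 2 * hnorm v ^+ 2.
Proof. by rewrite !hnorm_sqr !rdotE; ring. Qed.

Lemma ler_of_small_error (R : realFieldType) (a b k : R) :
  0 <= k -> (forall e, 0 < e -> a <= b + k * e) -> a <= b.
Proof.
move=> k0 h; apply/ler_addgt0Pr => e e0.
have k1 : 0 < k + 1 by rewrite ltr_wpDl.
apply: le_trans (h (e / (k + 1)) (divr_gt0 e0 k1)) _.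
by rewrite lerD2l mulrCA ger_pMr// ler_pdivrMr// mul1r lerDl.
Qed.

(** The first-order condition at a minimum: if a is nonzero, the quadratic is
    negative for small t of sign opposite to a. *)
Lemma linear_form_vanishes (R : realFieldType) (a b : R) :
  (forall t, 0 <= t * a + t ^+ 2 * b) -> a = 0.
Proof.
move=> h; pose c := 1 + `|b|.
have c0 : 0 < c by rewrite ltr_pwDl.
have bc : b < c by rewrite (le_lt_trans (ler_norm b))// ltrDr.
(* Since c exceeds b, the linear term dominates at t = - a / c. *)
have := h (- a / c); have -> : - a / c * a + (- a / c) ^+ 2 * b = - (a / c) ^+ 2 * (c - b).
  by field; rewrite gt_eqF.
rewrite mulNr oppr_ge0 pmulr_lle0 ?subr_gt0// => h'.
have /eqP : (a / c) ^+ 2 = 0 by apply: le_anti; rewrite h' sqr_ge0.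
by rewrite sqrf_eq0 mulf_eq0 invr_eq0 (gt_eqF c0) orbF => /eqP.
Qed.

(** * Representing a functional on the range of an operator *)

Section Representation.
Variables (R : realType) (U : lmodType (quaternion R)^c) (V : rightHilbertType R).
Variables (A : {linear U -> V}) (phi : U -> quaternion R) (C : R).
Hypothesis phiD : forall u v, phi (u + v) = phi u + phi v.
Hypothesis phiZ : forall (q : quaternion R) u,
  phi ((q : (quaternion R)^c) *: u) = phi u * q.
Hypothesis C_ge0 : 0 <= C.
Hypothesis phi_le : forall u, qre (phi u) <= C * hnorm (A u).

Let f u : R := qre (phi u).
(** If [phi u] is [⟨y, A u⟩], this is [|A u - y|^2 - |y|^2]: minimising it means
    approaching y within the range of A. *)
Let energy u : R := hnorm (A u) ^+ 2 - 2 * f u.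
Let scale (a : R) (u : U) : U := (a%:quat : (quaternion R)^c) *: u.

Let fD u v : f (u + v) = f u + f v.
Proof. by rewrite /f phiD. Qed.

Let fZ a u : f (scale a u) = a * f u.
Proof. by rewrite /f phiZ qre_mul_real mulrC. Qed.

Let AZ a u : A (scale a u) = rscale a (A u).
Proof. exact: linearZ. Qed.

Let energy_lbound u : - C ^+ 2 <= energy u.
Proof.
have := phi_le u; rewrite /energy /f => le.
by have := sqr_ge0 (hnorm (A u) - C); rewrite sqrrB; lra.
Qed.

Let energy_has_inf : has_inf (range energy).
Proof.
split; first by exists (energy 0), 0.
by exists (- C ^+ 2) => _ [u _ <-]; exact: energy_lbound.
Qed.

Let d := inf (range energy).

Let energy_ge u : d <= energy u.
Proof. by apply: ge_inf; [case: energy_has_inf|exists u]. Qed.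

Let near_minimizer e : 0 < e -> exists u, energy u < d + e.
Proof. by move=> e0; have [_ [u _ <-] ?] := inf_adherent e0 energy_has_inf; exists u. Qed.

(** Parallelogram law at the midpoint of u and v, whose energy is at least d:
    minimising sequences are therefore Cauchy. *)
Let energy_gap u v :
  hnorm (A u - A v) ^+ 2 <= 2 * (energy u - d) + 2 * (energy v - d).
Proof.
have := energy_ge (scale 2^-1 (u + v)).
rewrite /energy fZ fD AZ hnormZ linearD exprMn real_normK ?num_real//.
by have := hnorm_parallelogram (A u) (A v); lra.
Qed.

Let minimizing_limit : exists y, forall e, 0 < e ->
  exists2 u, hnorm (A u - y) <= e & energy u < d + e ^+ 2.
Proof.
(* Energies within (s n / 2)^2 of the infimum make the gap at most s n. *)
pose s n : R := n.+1%:R^-1.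
have s0 n : 0 < s n by rewrite invr_gt0.
have half n : 0 < (s n / 2) ^+ 2 by rewrite exprn_gt0// divr_gt0.
have [x xE] := choice (fun n => near_minimizer (half n)).
have [|n m nm|y yE] := @cauchy_modulus_limit R V (A \o x) s.
- exact: cvg_harmonic.
- have smn : s m <= s n by rewrite lef_pV2 ?posrE// ler_nat.
  apply: hnorm_le; first exact: ltW.
  rewrite -hnorm_sqr; apply: le_trans (energy_gap _ _) _.
  have := xE n; have := xE m; have : s m ^+ 2 <= s n ^+ 2.
    by rewrite ler_pXn2r// nnegrE ltW.
  by rewrite !expr_div_n; lra.
exists y => e e0; have [N Ne] : exists N, s N < e.
  have /cvgrPdist_lt/(_ e e0) [N _ /(_ N (leqnn N))] := @cvg_harmonic R.
  by rewrite /= sub0r normrN gtr0_norm//; exists N.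
exists (x N); first exact: le_trans (yE N) (ltW Ne).
apply: lt_le_trans (xE N) _; rewrite lerD2l expr_div_n.
have : s N ^+ 2 <= e ^+ 2 by rewrite ler_pXn2r ?nnegrE ?ltW.
by have := sqr_ge0 (s N); lra.
Qed.

(** The range of A need not be closed: y is found in its closure, as the limit
    of a minimising sequence, which is why y is orthogonal to all that is
    orthogonal to the range.  With A the identity this is the usual Riesz
    theorem; with A an adjoint it solves an operator equation. *)
Lemma riesz_along_operator : exists y : V,
  [/\ forall u, ⟨y, A u⟩ = phi u, hnorm y <= C &
      forall z, (forall u, ⟨A u, z⟩ = 0) -> ⟨y, z⟩ = 0].
Proof.
have [y yE] := minimizing_limit.
(* Euler-Lagrange equation: perturb an almost-minimiser v to v + t u. *)
have yf u : rdot y (A u) = f u.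
  apply/eqP; rewrite -subr_eq0; apply/eqP.
  suff : 2 * (rdot y (A u) - f u) = 0 by lra.
  apply: (@linear_form_vanishes _ _ (hnorm (A u) ^+ 2)) => t.
  set g := rdot y (A u) - f u; set b := hnorm (A u).
  (* An error e' in v costs e'^2 in energy and 2 |t| b e' in the linear term. *)
  pose K := 1 + 2 * `|t| * b.
  have K0 : 0 < K by rewrite ltr_pwDl// !mulr_ge0 ?hnorm_ge0.
  apply/ler_addgt0Pr => e e0.
  pose e' := Num.min 1 (e / K).
  have e'0 : 0 < e' by rewrite lt_min ltr01 divr_gt0.
  have e'e : e' * K <= e by rewrite -ler_pdivlMr// /e' ge_min lexx orbT.
  have e'1 : e' ^+ 2 <= e' by rewrite expr2 ler_piMr ?(ltW e'0)// /e' ge_min lexx.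
  have [v vy vd] := yE _ e'0.
  have := energy_ge (v + scale t u).
  rewrite /energy fD fZ linearD AZ hnorm_sqr !rdotE -!hnorm_sqr (rdotC (A u)).
  move: vd; rewrite /energy => vd.
  have : t * (rdot (A v) (A u) - rdot y (A u)) <= `|t| * (e' * b).
    rewrite -rdotNl -rdotDl (le_trans (ler_norm _))// normrM ler_wpM2l//.
    rewrite (le_trans (rdot_abs_le _ _))// ler_wpM2r// ?hnorm_ge0//.
  rewrite -/b /g; move: e'e; rewrite /K; lra.
have ortho z : (forall u, ⟨A u, z⟩ = 0) -> rdot y z <= 0.
  move=> Az; apply: (@ler_of_small_error _ _ _ (hnorm z)) => [|e e0].
    exact: hnorm_ge0.
  have [u uy _] := yE _ e0.
  rewrite -[y](subrK (A u)) rdotDl {2}/rdot Az addr0 add0r mulrC.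
  by rewrite (le_trans (rdot_le _ _))// ler_wpM2r ?hnorm_ge0// hnormB.
exists y; split.
- move=> u; apply: quat_eq_of_re => r.
  by rewrite -hinnerZr -linearZ -phiZ; exact: yf.
- have [->|y0] := eqVneq (hnorm y) 0; first exact: C_ge0.
  have {}y0 : 0 < hnorm y by rewrite lt0r y0 hnorm_ge0.
  rewrite -(ler_pM2r y0) -expr2 hnorm_sqr.
  apply: (@ler_of_small_error _ _ _ (hnorm y + C)) => [|e e0].
    by rewrite addr_ge0// hnorm_ge0.
  have [u uy _] := yE _ e0.
  have -> : rdot y y = rdot y (y - A u) + f u by rewrite -yf -rdotDr subrK.
  have le1 : rdot y (y - A u) <= hnorm y * e.
    by rewrite (le_trans (rdot_le _ _))// ler_wpM2l ?hnorm_ge0// hnormB.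
  have le2 : C * hnorm (A u) <= C * (hnorm y + e).
    rewrite ler_wpM2l// -[A u](subrK y).
    by rewrite (le_trans (hnormD _ _))// addrC lerD2l.
  by have := phi_le u; rewrite -/(f u); lra.
- move=> z Az; apply: quat_eq_of_re => r; rewrite mul0r -hinnerZr.
  have Arz u : ⟨A u, (r : (quaternion R)^c) *: z⟩ = 0 by rewrite hinnerZr Az mul0r.
  apply: le_anti; rewrite ortho//= -oppr_le0 -rdotNr -scaleNr ortho// => u.
  by rewrite hinnerZr Az mul0r.
Qed.
End Representation.
(** * Adjoints *)

Section Adjoint.
Variables (R : realType) (U V : rightHilbertType R) (L : 'B(U, V)).

Lemma opbounded_ge0 : exists2 k : R, 0 <= k & forall u, hnorm (L u) <= k * hnorm u.
Proof.
have [k kP] := opbounded (s := L); exists `|k| => // u.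
by rewrite (le_trans (kP u))// ler_wpM2r ?hnorm_ge0// ler_norm.
Qed.

Lemma adjointP u v : ⟨L u, v⟩ = ⟨u, L^† v⟩.
Proof.
suff [w wP] : [set w | forall u, ⟨L u, v⟩ = ⟨u, w⟩] !=set0.
  by rewrite /adjoint; exact: (xgetPex _ (ex_intro _ w wP)).
have [k k0 kL] := opbounded_ge0.
have [||||w [wP _ _]] := @riesz_along_operator R U U idfun (fun u => ⟨v, L u⟩) (k * hnorm v).
- by move=> x y; rewrite linearD hinnerDr.
- by move=> q x; rewrite linearZ hinnerZr.
- by rewrite mulr_ge0// hnorm_ge0.
- move=> x; apply: le_trans (rdot_le v (L x)) _.
  by rewrite mulrAC mulrC ler_wpM2r// hnorm_ge0.
by exists w => x; rewrite hinnerC -wP -hinnerC.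
Qed.

Lemma adjoint_linear : linear (L^† : V -> U).
Proof.
move=> q u v; apply: hinner_ext => w.
by rewrite hinnerDr hinnerZr -!adjointP hinnerDr hinnerZr.
Qed.

HB.instance Definition _ :=
  GRing.isLinear.Build (quaternion R)^c V U *:%R (adjoint L) adjoint_linear.

Lemma hinner_op_adjoint u : ⟨L (L^† u), u⟩ = (hnorm (L^† u) ^+ 2)%:quat.
Proof. by rewrite adjointP hinner_self. Qed.

End Adjoint.

Lemma op_adjoint_leE (R : realType) (H1 H2 H : rightHilbertType R)
    (L : 'B(H1, H)) (M : 'B(H2, H)) (c : R) (u : H) :
  (⟨L (L^† u), u⟩ <= c%:quat * ⟨M (M^† u), u⟩) =
  (hnorm (L^† u) ^+ 2 <= c * hnorm (M^† u) ^+ 2).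
Proof. by rewrite !hinner_op_adjoint real_quatM ler_real_quat. Qed.

(** * Uniform boundedness *)

(** Move x along w by a distance r, in the direction of the sign of [rdot w x]:
    the two contributions to [rdot w x'] then add up instead of cancelling. *)
Lemma hump_step (R : realType) (V : rightPreHilbertType R) (x w : V) (r : R) :
  0 <= r -> exists x', hnorm (x' - x) <= r /\ r * hnorm w <= `|rdot w x'|.
Proof.
move=> r0; have [w0|w0] := eqVneq (hnorm w) 0.
  by exists x; rewrite subrr hnorm0 w0 mulr0 normr_ge0.
pose s : R := if 0 <= rdot w x then 1 else -1.
have s1 : `|s| = 1 by rewrite /s; case: ifP => _; rewrite ?normrN normr1.
have sx : s * rdot w x = `|rdot w x|.
  rewrite /s; case: (leP 0 (rdot w x)) => [/ger0_norm->|/ltr0_norm->].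
    exact: mul1r.
  exact: mulN1r.
exists (x + rscale (s * (r / hnorm w)) w); split.
  rewrite addrC addKr hnormZ !normrM s1 mul1r normfV (ger0_norm r0).
  by rewrite ger0_norm ?hnorm_ge0// divfK.
rewrite rdotDr rdotZr -hnorm_sqr -[leRHS]mul1r -s1 -normrM mulrDr sx.
have -> : s * (s * (r / hnorm w) * hnorm w ^+ 2) = `|s| ^+ 2 * (r * hnorm w).
  by rewrite real_normK ?num_real//; field.
rewrite s1 expr1n mul1r ger0_norm ?lerDr//.
by rewrite addr_ge0// mulr_ge0// hnorm_ge0.
Qed.

(** Gliding hump: if S is unbounded, pick [w n] in S with norm above [2 n 3^n]
    and build x as a limit of hump steps of length [3^-n], the n-th one along
    [w n].  After step n, [rdot (w n) x] is at least [3^-n |w n|] in absolute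
    value, and all later steps have total length [3^-n / 2], so they spoil at
    most half of it: the limit pairs with [w n] to more than n in absolute value. *)
Lemma uniform_boundedness (R : realType) (V : rightHilbertType R) (S : set V) :
  (forall x, exists B, forall w, S w -> rdot w x <= B) ->
  exists C, forall w, S w -> hnorm w <= C.
Proof.
move=> weak; apply: contrapT => unbounded.
have far n : exists w, S w /\ 2 * n%:R * 3 ^+ n < hnorm w.
  apply: contrapT => near; apply: unbounded; exists (2 * n%:R * 3 ^+ n) => w Sw.
  by rewrite leNgt; apply/negP => ?; apply: near; exists w.
have [w wP] := choice far.
pose r n : R := 3^-1 ^+ n.
have r_gt0 n : 0 < r n by rewrite exprn_gt0// invr_gt0.
have [g gP] := choice (fun p : nat * V => hump_step p.2 (w p.1) (ltW (r_gt0 p.1))).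
pose x := fix F n := if n is k.+1 then g (k, F k) else 0.
have rS n : r n.+1 = r n / 3 by rewrite /r exprSr.
(* 3 / 2 * (r n - r (n + k)) is the sum of the k step lengths from r n on. *)
have xB n k : hnorm (x (n + k)%N - x n) <= 3 / 2 * (r n - r (n + k)%N).
  elim: k => [|k IH]; first by rewrite addn0 !subrr hnorm0 mulr0.
  rewrite addnS -[_ - x n](subrKA (x (n + k)%N)).
  apply: le_trans (hnormD _ _) _.
  by have [/= + _] := gP ((n + k)%N, x (n + k)%N); rewrite rS; lra.
have [|n m nm|l lP] := @cauchy_modulus_limit R V x (fun n => 3 / 2 * r n).
- by apply: cvg_geometric; rewrite ger0_norm ?invr_ge0// invf_lt1// ltr1n.
- by rewrite -(subnKC nm); have := xB n (m - n)%N; have := r_gt0 (n + (m - n))%N; lra.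
(* Bounds at l and at - l together bound the absolute value. *)
have [[B BP] [B' BP']] := (weak l, weak (- l)).
pose n := Num.bound (`|B| + `|B'|).
have nB : `|B| + `|B'| < n%:R by rewrite archi_boundP// addr_ge0.
have [Sw wn] := wP n.
have wl : `|rdot (w n) l| <= `|B| + `|B'|.
  have := BP _ Sw; have := BP' _ Sw; rewrite rdotNr ler_norml => le1 le2.
  have := ler_norm B; have := ler_norm B'.
  have := normr_ge0 B; have := normr_ge0 B'; move=> *; apply/andP; split; lra.
have [_ /= hump] := gP (n, x n).
have tail : `|rdot (w n) (x n.+1) - rdot (w n) l| <= hnorm (w n) * (r n / 2).
  rewrite -rdotNr -rdotDr (le_trans (rdot_abs_le _ _))// ler_wpM2l ?hnorm_ge0//.
  by have := lP n.+1; rewrite rS; lra.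
have big : n%:R < r n / 2 * hnorm (w n).
  have rE : r n * 3 ^+ n = 1 by rewrite /r exprVn mulVf// expf_neq0.
  have := wn; rewrite -(ltr_pM2l (r_gt0 n)).
  have -> : r n * (2 * n%:R * 3 ^+ n) = 2 * n%:R * (r n * 3 ^+ n) by ring.
  by rewrite rE; lra.
have := ler_normD (rdot (w n) (x n.+1) - rdot (w n) l) (rdot (w n) l).
rewrite subrK -/(x n.+1); move: hump; rewrite -[g _]/(x n.+1).
lra.
Qed.

(** * Range inclusion, domination and factorisation *)

Section Douglas.
Variables (R : realType) (H1 H2 H : rightHilbertType R).
Variables (L : 'B(H1, H)) (M : 'B(H2, H)).

(** Weak boundedness on the set of [L^† u] with [M^† u] in the unit ball,
    followed by scaling. *)
Lemma range_sub_adjoint_bound : range L `<=` range M ->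
  exists2 C : R, 0 < C & forall u, hnorm (L^† u) <= C * hnorm (M^† u).
Proof.
move=> LM.
have [x|C CP] := @uniform_boundedness R H1 [set L^† u | u in [set u | hnorm (M^† u) <= 1]].
  have [y _ yx] := LM (L x) (imageT _ _); exists (hnorm y) => _ [u u1 <-].
  rewrite rdotC /rdot -adjointP -yx adjointP.
  by rewrite (le_trans (rdot_le _ _))// ler_piMr// hnorm_ge0.
exists (1 + `|C|) => [|u]; first by rewrite ltr_pwDl.
(* Scaling u by the inverse of |M^† u| + e rather than of |M^† u| also covers
   the u with M^† u = 0. *)
apply: (@ler_of_small_error _ _ _ (1 + `|C|)) => [|e e0]; first by rewrite addr_ge0.
have m0 := hnorm_ge0 (M^† u).
have me : 0 < hnorm (M^† u) + e by rewrite ltr_wpDl.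
rewrite -mulrDr -ler_pdivrMr//.
have nZ (K : rightHilbertType R) (T : {linear H -> K}) :
    hnorm (T (rscale (hnorm (M^† u) + e)^-1 u)) = hnorm (T u) / (hnorm (M^† u) + e).
  by rewrite linearZ hnormZ ger0_norm ?invr_ge0 ?ltW// mulrC.
rewrite -nZ (le_trans (CP _ _))//; last by rewrite ler_wpDl// ler_norm.
exists (rscale (hnorm (M^† u) + e)^-1 u) => //=.
by rewrite nZ ler_pdivrMr// mul1r lerDl ltW.
Qed.

(** Solve [M y = L x] with y orthogonal to the kernel of M; orthogonality makes
    the solution unique, hence linear in x. *)
Lemma adjoint_bound_factor (C : R) : 0 <= C ->
  (forall u, hnorm (L^† u) <= C * hnorm (M^† u)) ->
  exists X : 'B(H1, H2), L = M \o X :> (H1 -> H).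
Proof.
move=> C0 LM.
have sol x : exists y, [/\ M y = L x, hnorm y <= C * hnorm x &
    forall z, M z = 0 -> ⟨y, z⟩ = 0].
  have [||||y [yE yC yM]] := @riesz_along_operator R H H2 (adjoint M)
      (fun u => ⟨x, L^† u⟩) (C * hnorm x).
  - by move=> u v; rewrite linearD hinnerDr.
  - by move=> q u; rewrite linearZ hinnerZr.
  - by rewrite mulr_ge0// hnorm_ge0.
  - move=> u; apply: le_trans (rdot_le x _) _.
    by rewrite mulrAC mulrC ler_wpM2r ?hnorm_ge0.
  exists y; split=> // [|z Mz].
    by apply: hinner_ext => u; rewrite hinnerC adjointP yE -adjointP -hinnerC.
  by apply: yM => u; rewrite hinnerC -adjointP Mz hinnerC quat_conjK hinner0r.
have [X XP] := choice sol.
have Xlin : linear X.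
  move=> q u v; apply/eqP; rewrite -subr_eq0; apply/eqP.
  (* z lies in the kernel of M and is a combination of values of X, which are
     orthogonal to that kernel; so z is orthogonal to itself. *)
  set z := _ - _; have z_def : z = X (q *: u + v) - (q *: X u + X v) by [].
  have Mz : M z = 0.
    have MX x : M (X x) = L x by have [] := XP x.
    by rewrite z_def linearB linearP /= !MX linearP subrr.
  have Xz x : ⟨z, X x⟩ = 0.
    have [_ _ /(_ z Mz) h] := XP x.
    by rewrite hinnerC h; apply: quatP; rewrite /= ?oppr0.
  apply: hnorm_eq0; apply/eqP; rewrite -sqrf_eq0 hnorm_sqr /rdot {2}z_def -scaleN1r.
  by rewrite !(hinnerDr, hinnerZr) !Xz !(mul0r, addr0).
pose XB : 'B(H1, H2) := HB.pack X
  (GRing.isLinear.Build (quaternion R)^c H1 H2 *:%R X Xlin)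
  (isBoundedOp.Build R H1 H2 X (ex_intro _ C (fun x => let: And3 _ h _ := XP x in h))).
by exists XB; apply/funext => x /=; have [-> _ _] := XP x.
Qed.

End Douglas.

Theorem theorem5 (R : realType) (H1 H2 H : rightHilbertType R)
    (L : 'B(H1, H)) (M : 'B(H2, H)) :
  [<-> range L `<=` range M;
       exists2 c : R, 0 < c &
         forall u : H, ⟨L (L^† u), u⟩ <= c%:quat * ⟨M (M^† u), u⟩;
       exists X : 'B(H1, H2), L = M \o X :> (H1 -> H) ].
Proof.
tfae.
- move=> /range_sub_adjoint_bound[C C0 CP]; exists (C ^+ 2) => [|u].
    by rewrite exprn_gt0.
  rewrite op_adjoint_leE -exprMn ler_pXn2r ?nnegrE ?mulr_ge0 ?hnorm_ge0//.
  exact: ltW.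
- case=> c c0 cP; apply: (@adjoint_bound_factor _ _ _ _ _ _ (Num.sqrt c)) => [|u].
    exact: sqrtr_ge0.
  apply: hnorm_le; first by rewrite mulr_ge0 ?sqrtr_ge0 ?hnorm_ge0.
  by have := cP u; rewrite op_adjoint_leE -hnorm_sqr exprMn (sqr_sqrtr (ltW c0)).
- by case=> X LX _ [x _ <-]; exists (X x) => //; rewrite LX.
Qed.
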